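(* Let $1\le s<q<r\le\infty$ and let $\{T_t\}_{t\ge0}$ be a semigroup acting on some subset $D$ of $L^q(\Sigma,\mu)$ such that, for some $\omega\ge0$, $$\|T_tu-T_t\hat u\|_s\le e^{\omega t}\|u-\hat u\|_s\qquad\text{for every }u,\hat u\in D\cap L^s(\Sigma,\mu),\ t>0.$$ Suppose there exist $\alpha>0$, $\beta>0$, $\gamma>0$ and $C>0$ such that $$\|T_tu-T_t\hat u\|_r\le C\,t^{-\alpha}e^{\omega\beta t}\|u-\hat u\|_q^\gamma\qquad\text{for every }t>0,\ u,\hat u\in D.$$ Set $\theta_s=\frac{(r-q)s}{q(r-s)}$ if $r<\infty$ and $\theta_s=\frac sq$ if $r=\infty$, and assume that $\gamma(1-\theta_s)<1$. Then $$\|T_tu-T_t\hat u\|_r\le\Big(C\,2^{\frac{\alpha}{1-\gamma(1-\theta_s)}}\Big)^{\frac1{1-\gamma(1-\theta_s)}}t^{-\alpha_s}e^{\omega\beta_st}\|u-\hat u\|_s^{\gamma_s}$$ for every $t>0$ and $u,\hat u\in D\cap L^s(\Sigma,\mu)$, with exponents $$\alpha_s=\frac{\alpha}{1-\gamma(1-\theta_s)},\qquad\beta_s=\frac{(\beta/2)+\gamma\theta_s}{1-\gamma(1-\theta_s)},\qquad\gamma_s=\frac{\gamma\,\theta_s}{1-\gamma(1-\theta_s)}.$$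
   Context: $(\Sigma,\mu)$ is a $\sigma$-finite measure space and $\|\cdot\|_q$ is the norm of $L^q(\Sigma,\mu)$. A semigroup acting on $D$ is a family of (in general nonlinear) maps $T_t:D\to D$, $t\ge0$, with $T_{t+s}=T_t\circ T_s$ for all $t,s\ge0$. *)

(* Defs.v *)
From HB Require Import structures.
From mathcomp Require Import all_boot all_order all_algebra.
From mathcomp Require Import all_classical all_reals all_analysis.

Set Implicit Arguments.
Unset Strict Implicit.
Unset Printing Implicit Defensive.

Import Order.TTheory GRing.Theory Num.Theory.
Import numFieldNormedType.Exports.

Local Open Scope classical_set_scope.
Local Open Scope ring_scope.

(* The proof of [1 <= q] that the type [LspaceType mu _] asks for. *)
Lemma exponent_ge1 (R : realType) (s q : R) :
  1 <= s -> s < q -> (1 <= q%:E)%E.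
Proof. by move=> s1 sq; rewrite lee_fin (le_trans s1 (ltW sq)). Qed.

(* ||u - v||_p, with value +oo when u - v is not in L^p. For elements of an
   [LspaceType], which are a.e. classes, u and v are the representatives given
   by the coercion; the value does not depend on that choice. *)
Definition Ldist d (Sigma : measurableType d) (R : realType)
    (mu : {measure set Sigma -> \bar R}) (p : \bar R) (u v : Sigma -> R) :
    \bar R :=
  Lnorm mu p (EFin \o (fun x => u x - v x)).

(* Each T t is a total map of which only the restriction to D matters, and only
   for t >= 0. T 0 is not required to be the identity. *)
Definition semigroup_on (R : realType) (X : Type) (D : set X)
    (T : R -> X -> X) : Prop :=
  (forall t, 0 <= t -> set_fun D D (T t)) /\
  (forall t s, 0 <= t -> 0 <= s ->
     forall u, D u -> T (t + s) u = T t (T s u)).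

(* The value at r = -oo is irrelevant. *)
Definition theta (R : realType) (s q : R) (r : \bar R) : R :=
  if r is r'%:E then ((r' - q) * s) / (q * (r' - s)) else s / q.

(* Main.v *)
(* Extrapolation by interpolation. Put [th := theta s q r], so that
   [1 / q = th / s + (1 - th) / r], and [lam := gamma * (1 - th)], and let [F t]
   be the distance of [T t u] and [T t v] in [L^r]. Splitting the time [t] in
   two halves, applying the regularising estimate on the second half,
   interpolating [L^q] between [L^s] and [L^r], and using the growth estimate
   in [L^s] on the first half give
     [F t <= K * (t / 2) `^ (- alpha) * F (t / 2) `^ lam]
   with [K] a multiple of [||u - v||_s `^ (gamma * th)]. As [lam < 1], the
   right-hand side can be absorbed, the regularising estimate providing the
   a priori bound [F t = O(t `^ (- alpha))]. *)

Require Import Defs.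
From HB Require Import structures.
From mathcomp Require Import all_boot all_order all_algebra.
From mathcomp Require Import all_classical all_reals all_analysis.
From mathcomp Require Import measurable_realfun ess_sup_inf.
From mathcomp Require Import ring lra.

Set Implicit Arguments.
Unset Strict Implicit.
Unset Printing Implicit Defensive.

Import Order.TTheory GRing.Theory Num.Theory.
Import numFieldNormedType.Exports.

Local Open Scope classical_set_scope.
Local Open Scope ring_scope.

(** * Absorption of a sublinear power and iteration over halved times *)

(** Dividing by the power of [S] on the right leaves [S] to the power [1 - lam] at most [A], and a
    root of positive order is monotone. The case [S = 0], where the division fails, is trivial. *)
Lemma le_powR_absorb (R : realType) (S A lam : R) :
  lam < 1 -> 0 <= S -> 0 <= A -> S <= A * S `^ lam ->
  S <= A `^ (1 / (1 - lam)).
Proof.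
move=> lam1 S0 A0 SA; have l0 : 0 < 1 - lam by rewrite subr_gt0.
move: S0; rewrite le_eqVlt => /predU1P[<-|S0]; first exact: powR_ge0.
have SlA : S `^ (1 - lam) <= A.
  rewrite powRB ?(gt_eqF S0) ?implybT// powRr1 ?(ltW S0)//.
  by rewrite ler_pdivrMr ?powR_gt0.
have -> : S = (S `^ (1 - lam)) `^ (1 / (1 - lam)).
  by rewrite -powRrM mulrCA divff ?gt_eqF// mulr1 powRr1// ltW.
by rewrite ge0_ler_powR ?nnegrE ?powR_ge0// divr_ge0// ltW.
Qed.

(* The supremum [S] of [tau `^ a * F tau] over [0 < tau <= t] is finite and
   satisfies [S <= K * 2 `^ a * S `^ lam], which bounds [S] as [lam < 1]; the
   exponent [a] is the solution of [a = alpha + a * lam]. *)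
Lemma halving_bound (R : realType) (F : R -> R) (t alpha lam M K : R) :
  0 < t -> 0 <= alpha -> 0 <= lam -> lam < 1 -> 0 <= M -> 0 <= K ->
  (forall tau, 0 <= F tau) ->
  (forall tau, 0 < tau <= t -> F tau <= M * tau `^ (- alpha)) ->
  (forall tau, 0 < tau <= t ->
     F tau <= K * (tau / 2) `^ (- alpha) * F (tau / 2) `^ lam) ->
  F t <= (K * 2 `^ (alpha / (1 - lam))) `^ (1 / (1 - lam))
           * t `^ (- (alpha / (1 - lam))).
Proof.
move=> t0 alpha0 lam0 lam1 M0 K0 F0 FM FK.
set a := alpha / (1 - lam).
have l0 : 0 < 1 - lam by rewrite subr_gt0.
have a0 : 0 <= a by rewrite divr_ge0// ltW.
have aE : a - alpha = a * lam by rewrite /a; field; rewrite gt_eqF.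
pose G tau := tau `^ a * F tau.
have G0 tau : 0 <= G tau by rewrite mulr_ge0// powR_ge0.
pose E := [set G tau | tau in [set tau | 0 < tau <= t]].
have Et : E (G t) by exists t => //=; rewrite t0 lexx.
have ubE : has_sup E.
  split; first by exists (G t).
  (* The a priori bound leaves the power [a - alpha] of [tau]; this exponent equals [a * lam >= 0],
     so the power is largest at [t]. *)
  exists (M * t `^ (a - alpha)) => _ [tau /= /[dup] taut /andP[tau0 tt] <-].
  rewrite /G (le_trans (ler_wpM2l (powR_ge0 _ _) (FM _ taut)))//.
  rewrite mulrCA -powRD ?(gt_eqF tau0) ?implybT//.
  rewrite ler_wpM2l// ge0_ler_powR ?nnegrE ?(ltW tau0) ?(ltW t0)//.
  by rewrite aE mulr_ge0.
have ES x : E x -> x <= sup E by move=> Ex; exact: ub_le_sup (proj2 ubE) _ Ex.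
have S0 : 0 <= sup E by exact: le_trans (ES _ Et).
have SK : sup E <= K * 2 `^ a * sup E `^ lam.
  apply: ge_sup; first by exists (G t).
  move=> _ [tau /= /[dup] taut /andP[tau0 tt] <-].
  have h0 : 0 < tau / 2 by rewrite divr_gt0.
  have Eh : E (G (tau / 2)).
    by exists (tau / 2) => //=; rewrite h0/=; lra.
  rewrite /G (le_trans (ler_wpM2l (powR_ge0 _ _) (FK _ taut)))//.
  (* Writing [tau] as twice [tau / 2] produces the factor 2 to the power [a]. The remaining power of
     [tau / 2] has exponent [a - alpha = a * lam], exactly what [G (tau / 2)] to the power [lam]
     contains. *)
  rewrite [leLHS](_ : _ = K * 2 `^ a * G (tau / 2) `^ lam).
    rewrite ler_wpM2l ?mulr_ge0 ?powR_ge0// ge0_ler_powR ?nnegrE//.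
    exact: ES.
  rewrite [in RHS]powRM ?powR_ge0// -powRrM -aE powRD ?(gt_eqF h0) ?implybT//.
  rewrite [in LHS](_ : tau = 2 * (tau / 2)); last by field.
  by rewrite powRM ?(ltW h0)//= (_ : 2 * (tau / 2) / 2 = tau / 2); [ring|field].
have := le_powR_absorb lam1 S0 (mulr_ge0 K0 (powR_ge0 _ _)) SK.
move=> /(le_trans (ES _ Et)); rewrite /G mulrC -ler_pdivlMr ?powR_gt0//.
by rewrite powRN.
Qed.

(** * The interpolation exponent lies strictly between 0 and 1 *)

Lemma theta_gt0 (R : realType) (s q : R) (r : \bar R) :
  0 < s -> s < q -> (q%:E < r)%E -> 0 < theta s q r.
Proof.
move=> s0 sq; have q0 : 0 < q by exact: lt_trans sq.
case: r => [r| |]//=; last by rewrite divr_gt0.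
rewrite lte_fin => qr.
by rewrite divr_gt0// mulr_gt0// subr_gt0// (lt_trans sq).
Qed.

Lemma theta_lt1 (R : realType) (s q : R) (r : \bar R) :
  0 < s -> s < q -> (q%:E < r)%E -> theta s q r < 1.
Proof.
move=> s0 sq; have q0 : 0 < q by exact: lt_trans sq.
case: r => [r| |]//=; last by rewrite ltr_pdivrMr// mul1r.
rewrite lte_fin => qr; have sr := lt_trans sq qr.
rewrite ltr_pdivrMr ?mul1r ?mulr_gt0 ?subr_gt0//.
(* After expansion, this is [s * r < q * r]. *)
nra.
Qed.

(** * Interpolation of Lebesgue norms *)

Section interpolation.
Context (R : realType) (d : measure_display) (T : measurableType d).
Variable mu : {measure set T -> \bar R}.

(** Hölder's inequality for the factorisation of |f|^q into the powers [q * th] and [q * (1 - th)]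
    of |f|, with exponents chosen so that the factors become |f|^s and |f|^r. *)
Lemma Lnorm_interpolation_fin (f : T -> R) (s q r : R) :
  measurable_fun setT f -> 0 < s -> s < q -> q < r ->
  (Lnorm mu q%:E (EFin \o f)
     <= Lnorm mu s%:E (EFin \o f) `^ theta s q r%:E
        * Lnorm mu r%:E (EFin \o f) `^ (1 - theta s q r%:E))%E.
Proof.
move=> mf s0 sq qr; have q0 : 0 < q by exact: lt_trans sq.
have r0 : 0 < r by exact: lt_trans qr.
have rs : r - s != 0 by rewrite subr_eq0 gt_eqF// (lt_trans sq).
have := @theta_gt0 _ s q r%:E s0 sq; rewrite lte_fin => /(_ qr).
have := @theta_lt1 _ s q r%:E s0 sq; rewrite lte_fin => /(_ qr).
set th := theta _ _ _ => th1 th0.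
have th1' : 0 < 1 - th by rewrite subr_gt0.
have mpow p : measurable_fun setT (fun x => `|f x| `^ p).
  apply: (@measurableT_comp _ _ _ _ _ _ (@powR R ^~ p)) => //.
  exact: measurableT_comp.
have := @hoelder _ _ _ mu (fun x => `|f x| `^ (q * th))
  (fun x => `|f x| `^ (q * (1 - th))) (s / (q * th)) (r / (q * (1 - th)))
  (mpow _) (mpow _).
have p1 : 0 < s / (q * th) by rewrite divr_gt0// mulr_gt0.
have p2 : 0 < r / (q * (1 - th)) by rewrite divr_gt0// mulr_gt0.
have qth0 : q * th != 0 by rewrite mulf_neq0// gt_eqF.
have qth1 : q * (1 - th) != 0 by rewrite mulf_neq0// gt_eqF.
move=> /(_ p1 p2); rewrite !invf_div.
(* The exponents are conjugate: this is the identity defining [th], multiplied by [q]. *)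
have -> : q * th / s + q * (1 - th) / r = 1.
  rewrite /th /=; field.
  by rewrite rs !gt_eqF.
move=> /(_ erefl).
rewrite Lnorm1 unlock !invf_div.
under [X in (X <= _ -> _)%E]eq_integral => x _.
  rewrite /= ger0_norm ?mulr_ge0 ?powR_ge0// -powRD; last first.
    by rewrite -mulrDr subrKC mulr1 gt_eqF.
  rewrite -mulrDr subrKC mulr1; over.
under [X in (_ <= X `^ _ * _ -> _)%E]eq_integral => x _.
  rewrite /= ger0_norm ?powR_ge0// -powRrM mulrC divfK ?qth0//; over.
under [X in (_ <= _ * X `^ _ -> _)%E]eq_integral => x _.
  rewrite /= ger0_norm ?powR_ge0// -powRrM mulrC divfK ?qth1//; over.
move=> H.
have {H}H := gt0_ler_poweR (r := q^-1) _ _ _ H.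
apply: le_trans (H _ _ _) _.
- by rewrite invr_ge0 ltW.
- by rewrite in_itv/= leey andbT integral_ge0// => x _; rewrite lee_fin powR_ge0.
- by rewrite in_itv/= leey andbT mule_ge0// poweR_ge0.
rewrite poweRM ?poweR_ge0// -!poweRrM.
rewrite (_ : q * th / s * q^-1 = s^-1 * th); last by field; rewrite !gt_eqF.
rewrite (_ : q * (1 - th) / r * q^-1 = r^-1 * (1 - th))//.
by field; rewrite !gt_eqF.
Qed.

(** For [r = +oo], with [M] the essential bound of |f|, the pointwise estimate |f|^q <= |f|^s M^(q -
    s) is integrated, and the root of order [q] is taken. *)
Lemma Lnorm_interpolation (f : T -> R) (s q : R) (r : \bar R) :
  measurable_fun setT f -> 0 < s -> s < q -> (q%:E < r)%E ->
  finite_norm mu r f ->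
  (Lnorm mu q%:E (EFin \o f)
     <= Lnorm mu s%:E (EFin \o f) `^ theta s q r
        * Lnorm mu r (EFin \o f) `^ (1 - theta s q r))%E.
Proof.
move=> mf s0 sq; have q0 : 0 < q by exact: lt_trans sq.
case: r => [r| |]//; first by rewrite lte_fin => *; exact: Lnorm_interpolation_fin.
move=> _; rewrite /finite_norm => fy; rewrite /theta.
have := @Lnorm_ge0 _ _ _ mu +oo%E (EFin \o f).
move: fy; case ME : (Lnorm _ +oo _) => [M| |]// _; rewrite lee_fin => M0.
have fM : \forall x \ae mu, `|f x| <= M.
  move: ME; rewrite unlock; case: ifPn => [_ ME|mu0 _].
    have := ess_sup_ge mu (abse \o (EFin \o f)).
    by rewrite ME; apply: filterS => x.
  (* Here the whole space is null and the norm is 0 by convention, so the whole space serves as the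
     exceptional set. *)
  exists setT; split => //; apply/eqP.
  by rewrite eq_le measure_ge0 andbT leNgt.
rewrite poweR_EFin unlock.
have mpow p : measurable_fun setT (fun x => `|f x| `^ p).
  apply: (@measurableT_comp _ _ _ _ _ _ (@powR R ^~ p)) => //.
  exact: measurableT_comp.
have I0 : (0 <= \int[mu]_x (`|f x| `^ s)%:E)%E.
  by apply: integral_ge0 => x _; rewrite lee_fin powR_ge0.
have H : (\int[mu]_x (`|f x| `^ q)%:E
          <= \int[mu]_x (`|f x| `^ s)%:E * (M `^ (q - s))%:E)%E.
  rewrite -ge0_integralZr//; last 2 first.
  - exact/measurable_EFinP.
  - by rewrite lee_fin powR_ge0.
  apply: ae_ge0_le_integral => //.
  - exact/measurable_EFinP.
  - by move=> x _; rewrite -EFinM lee_fin mulr_ge0 ?powR_ge0.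
  - by apply: emeasurable_funM => //; exact/measurable_EFinP.
  apply: filterS fM => x fxM _; rewrite -EFinM lee_fin.
  rewrite -{1}(subrKC s q) (@powRD _ _ s); last by rewrite subrKC gt_eqF.
  rewrite ler_wpM2l ?powR_ge0// ge0_ler_powR ?nnegrE//.
  by rewrite subr_ge0 ltW.
have {}H := gt0_ler_poweR (r := q^-1) _ _ _ H.
apply: le_trans (H _ _ _) _.
- by rewrite invr_ge0 ltW.
- by rewrite in_itv/= leey andbT integral_ge0// => x _; rewrite lee_fin powR_ge0.
- by rewrite in_itv/= leey andbT mule_ge0// lee_fin powR_ge0.
rewrite poweRM ?lee_fin ?powR_ge0// -!poweRrM poweR_EFin -powRrM.
rewrite (_ : (q - s) / q = 1 - s / q); last by field; rewrite gt_eqF.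
by rewrite mulKf ?gt_eqF.
Qed.

Lemma Ldist_ge0 (p : \bar R) (f g : T -> R) : (0 <= Ldist mu p f g)%E.
Proof. exact: Lnorm_ge0. Qed.

Lemma Ldist_lty (p : \bar R) (f g : T -> R) :
  measurable_fun setT f -> measurable_fun setT g -> (1 <= p)%E ->
  finite_norm mu p f -> finite_norm mu p g -> (Ldist mu p f g < +oo)%E.
Proof.
move=> mf mg p1 ff fg.
have mNg : measurable_fun setT (fun x => - g x) by exact: measurableT_comp.
apply: (le_lt_trans (eminkowski _ mf mNg p1)); apply: lte_add_pinfty => //.
rewrite (_ : EFin \o _ = \- (EFin \o g))%E//.
by rewrite oppe_Lnorm.
Qed.

(** The real bound [b] also supplies the finiteness in L^r on which interpolation relies. *)
Lemma Ldist_interpolation (f g : T -> R) (s q : R) (r : \bar R) (a b : R) :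
  measurable_fun setT f -> measurable_fun setT g ->
  0 < s -> s < q -> (q%:E < r)%E ->
  (Ldist mu s%:E f g <= a%:E)%E -> (Ldist mu r f g <= b%:E)%E ->
  (Ldist mu q%:E f g <= (a `^ theta s q r * b `^ (1 - theta s q r))%:E)%E.
Proof.
move=> mf mg s0 sq qr sa rb.
have th0 := theta_gt0 s0 sq qr; have th1 := theta_lt1 s0 sq qr.
have ry : finite_norm mu r (fun x => f x - g x).
  exact: le_lt_trans rb (ltry _).
have mfg : measurable_fun setT (fun x => f x - g x) by exact: measurable_funB.
apply: le_trans (Lnorm_interpolation mfg s0 sq qr ry) _.
have itvE (x : \bar R) : (0 <= x)%E -> x \in `[0%E, +oo%E].
  by move=> x0; rewrite in_itv/= x0 leey.
rewrite EFinM -!poweR_EFin lee_pmul ?poweR_ge0//; apply: gt0_ler_poweR => //.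
- exact: ltW.
- exact/itvE/Ldist_ge0.
- exact/itvE/(le_trans (Ldist_ge0 _ _ _) sa).
- by rewrite subr_ge0 ltW.
- exact/itvE/Ldist_ge0.
- exact/itvE/(le_trans (Ldist_ge0 _ _ _) rb).
Qed.

End interpolation.

(** * Extrapolation of the smoothing estimate from L^q to L^s *)

Theorem theorem4p1 (R : realType) (d : measure_display)
    (Sigma : measurableType d)
    (mu : {sigma_finite_measure set Sigma -> \bar R})
    (s q : R) (r : \bar R)
    (s_ge1 : 1 <= s) (s_lt_q : s < q) (q_lt_r : (q%:E < r)%E)
    (D : set (LspaceType mu (exponent_ge1 s_ge1 s_lt_q)))
    (T : R -> LspaceType mu (exponent_ge1 s_ge1 s_lt_q) ->
              LspaceType mu (exponent_ge1 s_ge1 s_lt_q))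
    (T_semigroup : semigroup_on D T)
    (omega : R) (omega_ge0 : 0 <= omega)
    (T_growth : forall t, 0 < t -> forall u v,
       D u -> finite_norm mu s%:E u -> D v -> finite_norm mu s%:E v ->
       (Ldist mu s%:E (T t u) (T t v)
          <= (expR (omega * t))%:E * Ldist mu s%:E u v)%E)
    (alpha beta gamma C : R)
    (alpha_gt0 : 0 < alpha) (beta_gt0 : 0 < beta)
    (gamma_gt0 : 0 < gamma) (C_gt0 : 0 < C)
    (T_regularising : forall t, 0 < t -> forall u v, D u -> D v ->
       (Ldist mu r (T t u) (T t v)
          <= (C * t `^ (- alpha) * expR (omega * beta * t))%:E
               * Ldist mu q%:E u v `^ gamma)%E)
    (gamma_theta_lt1 : gamma * (1 - theta s q r) < 1) :
  let theta_s := theta s q r in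
  let alpha_s := alpha / (1 - gamma * (1 - theta_s)) in
  let beta_s := (beta / 2 + gamma * theta_s)
                  / (1 - gamma * (1 - theta_s)) in
  let gamma_s := gamma * theta_s / (1 - gamma * (1 - theta_s)) in
  forall t, 0 < t -> forall u v,
    D u -> finite_norm mu s%:E u -> D v -> finite_norm mu s%:E v ->
    (Ldist mu r (T t u) (T t v)
       <= ((C * 2 `^ (alpha / (1 - gamma * (1 - theta_s))))
             `^ (1 / (1 - gamma * (1 - theta_s)))
           * t `^ (- alpha_s) * expR (omega * beta_s * t))%:E
          * Ldist mu s%:E u v `^ gamma_s)%E.
Proof.
set lam := gamma * (1 - theta s q r) in gamma_theta_lt1 *.
move=> th a b g t t0 u v Du su Dv sv.
have s0 : 0 < s by exact: (lt_le_trans ltr01 s_ge1).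
have q1 : (1 <= q%:E)%E by exact: (exponent_ge1 s_ge1 s_lt_q).
have th0 : 0 < th by exact: theta_gt0.
have th1 : th < 1 by exact: theta_lt1.
have lam0 : 0 <= lam by rewrite mulr_ge0 ?subr_ge0 ?ltW.
have l0 : 0 < 1 - lam by rewrite subr_gt0.
have mf (x : LspaceType mu (exponent_ge1 s_ge1 s_lt_q)) :
    measurable_fun setT (x : Sigma -> R).
  exact: (@measurable_funPT _ _ _ _ (repr (LebesgueSpace.sort x))).
have [B B0 BE] : exists2 B : R, 0 <= B & Ldist mu q%:E u v = B%:E.
  have := Ldist_lty (mf u) (mf v) q1 (@Lebesgue_finite _ _ _ _ _ _ u) 
    (@Lebesgue_finite _ _ _ _ _ _ v).
  have := Ldist_ge0 mu q%:E u v.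
  by case: Ldist => [B| |]// B0 _; exists B.
have [N N0 NE] : exists2 N : R, 0 <= N & Ldist mu s%:E u v = N%:E.
  have := Ldist_lty (mf u) (mf v) (s_ge1 : (1 <= s%:E)%E) su sv.
  have := Ldist_ge0 mu s%:E u v.
  by case: Ldist => [N| |]// N0 _; exists N.
(* [fine] would turn an infinite distance into 0; the regularising estimate excludes this at
   positive times. *)
pose F tau := fine (Ldist mu r (T tau u) (T tau v)).
have F0 tau : 0 <= F tau by rewrite fine_ge0// Ldist_ge0.
have FE tau : 0 < tau -> Ldist mu r (T tau u) (T tau v) = (F tau)%:E.
  move=> tau0; rewrite /F fineK// ge0_fin_numE ?Ldist_ge0//.
  by rewrite (le_lt_trans (T_regularising _ tau0 _ _ Du Dv))// BE -EFinM ltry.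
have FM tau : 0 < tau <= t ->
    F tau <= C * expR (omega * beta * t) * B `^ gamma * tau `^ (- alpha).
  move=> /andP[tau0 taut].
  have := T_regularising _ tau0 _ _ Du Dv.
  rewrite BE FE// poweR_EFin -EFinM lee_fin => /le_trans; apply.
  rewrite [leLHS](_ : _ = C * expR (omega * beta * tau) * B `^ gamma
    * tau `^ (- alpha)); last by ring.
  do 2 (apply: ler_wpM2r; first exact: powR_ge0).
  by rewrite ler_pM2l// ler_expR ler_wpM2l// mulr_ge0// ltW.
(* The numerator of [beta_s]. *)
pose kappa := beta / 2 + gamma * th.
have kappa0 : 0 <= kappa by rewrite addr_ge0 ?mulr_ge0 ?invr_ge0 ?ltW.
pose K := C * expR (omega * kappa * t) * N `^ (gamma * th).
have K0 : 0 <= K by rewrite !mulr_ge0 ?expR_ge0 ?powR_ge0// ltW.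
have FK tau : 0 < tau <= t ->
    F tau <= K * (tau / 2) `^ (- alpha) * F (tau / 2) `^ lam.
  move=> /andP[tau0 taut].
  have h0 : 0 < tau / 2 by rewrite divr_gt0.
  have hh : tau = tau / 2 + tau / 2 by field.
  move: h0 hh; set h := tau / 2 => h0 hh.
  have [TD TT] := T_semigroup.
  have Th x : D x -> T tau x = T h (T h x).
    by move=> Dx; rewrite hh TT// ltW.
  have Ls := T_growth h h0 u v Du su Dv sv.
  rewrite NE -EFinM in Ls.
  have Lr : (Ldist mu r (T h u) (T h v) <= (F h)%:E)%E by rewrite FE.
  (* At time [h], the distance in L^q is controlled by the grown distance in L^s and by [F h]; the
     second half-step then starts from this bound. *)
  have Lq := Ldist_interpolation (mf _) (mf _) s0 s_lt_q q_lt_r Ls Lr.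
  have := T_regularising h h0 _ _ (TD h (ltW h0) u Du) (TD h (ltW h0) v Dv).
  rewrite -!Th// FE// => /le_trans; rewrite -lee_fin; apply.
  apply: (@le_trans _ _ ((C * h `^ (- alpha) * expR (omega * beta * h))%:E *
     ((expR (omega * h) * N) `^ th * F h `^ (1 - th))%:E `^ gamma)%E).
    apply: lee_wpmul2l.
      by rewrite lee_fin !mulr_ge0 ?powR_ge0 ?expR_ge0// ltW.
    apply: gt0_ler_poweR => //; first exact: ltW.
    - by rewrite in_itv/= Ldist_ge0 leey.
    - by rewrite in_itv/= lee_fin mulr_ge0 ?powR_ge0//= leey.
  rewrite poweR_EFin -EFinM lee_fin.
  rewrite powRM ?powR_ge0// -!powRrM powRM ?expR_ge0//.
  rewrite [th * gamma]mulrC [(1 - th) * gamma]mulrC -/lam.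
  rewrite -expRM.
  rewrite /K [leLHS](_ : _ =
    C * (expR (omega * beta * h) * expR (omega * h * (gamma * th)))
    * N `^ (gamma * th) * h `^ (- alpha) * F h `^ lam); last by ring.
  do 3 (apply: ler_wpM2r; first exact: powR_ge0).
  rewrite ler_pM2l// -expRD ler_expR.
  (* The two half-steps give the rate [beta / 2 + gamma * th / 2]; [kappa] keeps the whole
     [gamma * th], which leaves a nonnegative slack. *)
  apply: (@le_trans _ _ (omega * kappa * tau)); last first.
    by rewrite ler_wpM2l// mulr_ge0.
  rewrite -subr_ge0 (_ : _ - _ = omega * h * (gamma * th)); last first.
    by rewrite /kappa /h; field.
  by rewrite !mulr_ge0// ltW.
have := halving_bound t0 (ltW alpha_gt0) lam0 gamma_theta_lt1 _ K0 F0 FM FK.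
move=> /(_ (mulr_ge0 (mulr_ge0 (ltW C_gt0) (expR_ge0 _)) (powR_ge0 _ _))).
rewrite FE// NE poweR_EFin -EFinM lee_fin => /le_trans; apply.
rewrite /K /g /b /a -/kappa -/lam.
(* The power [1 / (1 - lam)] is distributed over the constant, the exponential and [N], turning
   [kappa] into [beta_s] and [gamma * th] into [gamma_s]. *)
rewrite [C * _ * _ * _](_ : _ =
  C * 2 `^ (alpha / (1 - lam)) * expR (omega * kappa * t) * N `^ (gamma * th));
  last by ring.
rewrite div1r powRM ?mulr_ge0 ?expR_ge0 ?powR_ge0 ?(ltW C_gt0)//.
rewrite powRM ?mulr_ge0 ?expR_ge0 ?powR_ge0 ?(ltW C_gt0)//.
rewrite -expRM -powRrM.
rewrite [in leRHS](_ : omega * (kappa / _) * t = omega * kappa * t / (1 - lam)).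
  by rewrite le_eqVlt; apply/predU1P; left; ring.
by ring.
Qed.
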